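(* Consider the noise-free 2-leader selection problem in a perfect ternary tree with root $r$, height $h\ge4$ and $n$ nodes. The optimal leaders $x,y$, whose lowest common ancestor is $r$, are such that $d_{xy}=2$ and $d_{xr}=1$, and the resulting coherence with $S=\{x,y\}$ is $$ R_{NF}(S)=\frac{2n+1}{4}\left(\log_3(2n+1)-2\right)+1 . $$
   Context: A perfect ternary tree is a rooted tree in which all non-leaf nodes have exactly $3$ children and all leaves are on the same level; the root is at level $0$ and the leaves at level $h$ (the height), so $n=(3^{h+1}-1)/2$. All edge weights equal $1$, and $d_{uv}$ is the graph distance (number of edges) between $u$ and $v$. The leaders are labelled so that $x$ is on a level no greater than that of $y$. For a connected graph with Laplacian $L$ and nonempty leader set $S\subseteq V$, let $L_{ff}$ be the principal submatrix of $L$ indexed by $V\setminus S$. The coherence for noise-free leaders $S$ (total steady-state variance of the followers under $\dot x_f=-L_{ff}x_f+d_f$, with $d_f$ a vector of zero-mean unit-variance white noise processes) is $$R_{NF}(S)=\tfrac12\operatorname{tr}(L_{ff}^{-1}).$$ The noise-free 2-leader selection problem is to minimize $R_{NF}(S)$ over nonempty $S\subseteq V$ with $|S|\le2$. *)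

(* Defs.v *)
From HB Require Import structures.
From mathcomp Require Import all_boot all_order all_algebra.
From mathcomp Require Import reals.

Set Implicit Arguments.
Unset Strict Implicit.
Unset Printing Implicit Defensive.

Import Order.TTheory GRing.Theory Num.Theory.
Local Open Scope ring_scope.

Section Graphs.
Variables (T : finType) (e : rel T).

Definition simple_graph := symmetric e /\ irreflexive e.

Definition walk (n : nat) (u v : T) : bool :=
  [exists p : n.-tuple T, path e u p && (last u p == v)].

(* Least length of a walk from u to v; #|T| when there is none (a shortest
   walk has fewer than #|T| edges). *)
Definition dist (u v : T) : nat := find (fun n => walk n u v) (iota 0 #|T|).

(* Since e is symmetric, [:: u; v] is a ucycle for every edge: a cycle of the
   graph is a ucycle with at least 3 vertices. *)
Definition is_tree :=
  [/\ simple_graph, forall u v, connect e u v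
    & forall c : seq T, ucycle e c -> (size c <= 2)%N].

Section Rooted.
Variable r : T.

Definition level (v : T) : nat := dist r v.

Definition child (u v : T) : bool := e u v && (level v == (level u).+1).

Definition children (u : T) : {set T} := [set v | child u v].

Definition is_leaf (u : T) : bool := children u == set0.

Definition perfect_ternary_tree (h : nat) :=
  [/\ is_tree,
      forall u, ~~ is_leaf u -> #|children u| = 3%N
    & forall u, is_leaf u -> level u = h].

(* Every vertex is an ancestor of itself. *)
Definition ancestor (u v : T) : bool := connect child u v.

Definition is_lca (w x y : T) :=
  [/\ ancestor w x, ancestor w y
    & forall z, ancestor z x -> ancestor z y -> (level z <= level w)%N].

End Rooted.

Section Coherence.
Variable R : realType.

Definition adjacency : 'M[R]_#|T| :=
  \matrix_(i, j) (e (enum_val i) (enum_val j))%:R.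

Definition degrees : 'rV[R]_#|T| := \row_i #|e (enum_val i)|%:R.

Definition laplacian : 'M[R]_#|T| := diag_mx degrees - adjacency.

Definition principal_submx (A : {set T}) (M : 'M[R]_#|T|) : 'M[R]_#|A| :=
  let f (i : 'I_#|A|) := enum_rank (enum_val i) in mxsub f f M.

Definition coherence (S : {set T}) : R :=
  2^-1 * \tr (invmx (principal_submx (~: S) laplacian)).

Definition optimal_leaders (k : nat) (S : {set T}) :=
  [/\ S != set0, (#|S| <= k)%N
    & forall S' : {set T}, S' != set0 -> (#|S'| <= k)%N ->
        coherence S <= coherence S'].

End Coherence.
End Graphs.

(* Main.v *)
Require Import Defs.
From mathcomp Require Import all_boot all_order all_algebra.
From mathcomp Require Import reals exp.
From mathcomp Require Import zify ring lra.

Set Implicit Arguments.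
Unset Strict Implicit.
Unset Printing Implicit Defensive.

Import Order.TTheory GRing.Theory Num.Theory.
Local Open Scope ring_scope.

(** In a tree, grounding the leaders turns the diagonal of the inverse of the
    follower Laplacian into effective resistances.  They are explicit once one
    knows the Green function of the Laplacian grounded at the root r, which is
    c(u,v), the level of the lowest common ancestor of u and v
    ([laplacian_common_level]).  Moving the ground from r to x, then adding y
    by a rank-one correction, gives [coherence_pair]: twice the coherence of
    the leaders x, y is the sum over v of
      l - 2 i + a - (a + j - i - q)^2 / (a + b - 2 q)
    where l, a, b are the levels of v, x, y, and i = c(v,x), j = c(v,y),
    q = c(x,y).

    Let m = (3^h - 1)/2 be the size of the subtree below a child of the root,
    so that n = 3 m + 1, and let Lam be the sum of all levels.  Two distinct
    children of the root give exactly Lam - 2 m + (m + 1)/2.  Every other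
    choice of leaders gives strictly more:
    - if x and y lie below different children of the root, each of the two
      branches contributes at least its sum of levels minus m, because the sum
      over v of c(v,x)^2 is at most a m ([sum_sqr_common_level]); the remaining
      m + 1 vertices see the leaders through the root, at resistance
      a b / (a + b), which exceeds 1/2 unless a = b = 1;
    - if one of the leaders is the root, the same estimate loses only m;
    - if x and y lie below the same child of the root, the resistance at v is
      at least its distance l - i - j + q to the path from x to y, and
      2 times the sum over v of c(v,x) is at most 3 m ([sum_common_level]);
    - a single leader is handled by that last estimate as well.
    Both estimates on c express that a subtree is more than three times as
    large as the subtree below one of its children. *)

(** * Walks and distances *)
Section Distance.
Variables (T : finType) (e : rel T).
Local Open Scope nat_scope.

Lemma walkP n u v :
  reflect (exists p, [/\ path e u p, last u p = v & size p = n]) (walk e n u v).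
Proof.
apply: (iffP existsP) => [[p /andP[ep /eqP lp]]|[p [ep lp sp]]].
  by exists p; split; rewrite ?size_tuple.
by exists (Tuple (introT eqP sp)); rewrite /= ep lp eqxx.
Qed.

Lemma dist_leq u p : path e u p -> dist e u (last u p) <= size p.
Proof.
move=> ep; rewrite leqNgt; apply/negP => lt_p.
have lt_pT : size p < #|T|.
  by rewrite (leq_trans lt_p)// -[leqRHS](size_iota 0) find_size.
have := before_find 0 lt_p; rewrite nth_iota// add0n.
by move/negbT/negP; apply; apply/walkP; exists p.
Qed.

Lemma dist_path u v : connect e u v ->
  exists p, [/\ path e u p, last u p = v & size p = dist e u v].
Proof.
case/connectP => p0 /shortenP[p ep up _ ->].
have lt_pT : size p < #|T| by have := card_uniqP up => /= <-; exact: max_card.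
have hasw : has (fun n => walk e n u (last u p)) (iota 0 #|T|).
  apply/hasP; exists (size p); first by rewrite mem_iota.
  by apply/walkP; exists p.
have := nth_find 0 hasw; rewrite nth_iota; last by rewrite -[ltnRHS](size_iota 0) -has_find.
by rewrite add0n => /walkP.
Qed.

Lemma distxx u : dist e u u = 0.
Proof. by apply/eqP; rewrite -leqn0; exact: (@dist_leq u [::]). Qed.

Lemma dist_eq0 u v : connect e u v -> dist e u v = 0 -> u = v.
Proof. by case/dist_path => -[|x p] [_ <- /=] // <-. Qed.

End Distance.

(** * Parents, children and ancestors in a rooted tree *)
Section RootedTree.
Variables (T : finType) (e : rel T) (r : T).
Hypothesis tree : is_tree e.
Local Open Scope nat_scope.
Local Notation lev := (level e r).
Local Notation ch := (child e r).
Local Notation anc := (ancestor e r).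

Let e_sym : symmetric e. Proof. by case: tree => -[]. Qed.
Let e_irr : irreflexive e. Proof. by case: tree => -[]. Qed.
Let e_conn u v : connect e u v. Proof. by case: tree. Qed.

Lemma level_root : lev r = 0. Proof. exact: distxx. Qed.

Lemma level_eq0 v : (lev v == 0) = (v == r).
Proof.
apply/eqP/eqP => [/(dist_eq0 (e_conn _ _))//|->]; exact: level_root.
Qed.

Lemma level_edge u v : e u v -> lev v <= (lev u).+1.
Proof.
move=> euv; have [p [ep lp sp]] := dist_path (e_conn r u).
have := @dist_leq _ e r (rcons p v); rewrite rcons_path last_rcons size_rcons.
by rewrite ep lp euv sp; apply.
Qed.

Lemma parent_exists v : v != r -> exists u, ch u v.
Proof.
move=> vr; have [p [ep lp sp]] := dist_path (e_conn r v).
case/lastP: p ep lp sp => [|p x]; first by move=> _ /= rv; rewrite rv eqxx in vr.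
rewrite rcons_path last_rcons size_rcons => /andP[ep ex] xv; subst x.
rewrite -/(level e r v) => sp; exists (last r p); rewrite /child ex eqn_leq level_edge//=.
by rewrite -sp ltnS dist_leq.
Qed.

Lemma level_child u v : ch u v -> lev v = (lev u).+1.
Proof. by case/andP => _ /eqP. Qed.

Lemma child_neq_root u v : ch u v -> v != r.
Proof. by move/level_child => lv; rewrite -level_eq0 lv. Qed.

(** Climbing from w to the root strictly decreases the level, so it cannot
    meet a vertex v that lies at least as low as w. *)
Lemma connect_root_avoiding v w : v != r -> w != v -> lev w <= lev v ->
  connect [rel x y | [&& e x y, x != v & y != v]] w r.
Proof.
move=> vr; have [n] := ubnP (lev w); elim: n w => // n IHn w lt_wn wv le_wv.
have [->//|wr] := eqVneq w r.
have [p cpw] := parent_exists wr; have lw := level_child cpw.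
have pv : p != v by apply: contraTneq le_wv => <-; rewrite lw ltnn.
apply: connect_trans (IHn p _ pv _); [|lia|lia].
by apply: connect1; rewrite /= e_sym wv pv; case/andP: cpw => ->.
Qed.

(** Two such neighbours would both be joined to the root away from v, hence
    joined to each other away from v, and v would lie on a cycle. *)
Lemma lower_neighbor_uniq u1 u2 v : e u1 v -> e u2 v ->
  lev u1 <= lev v -> lev u2 <= lev v -> u1 = u2.
Proof.
move=> e1 e2 l1 l2; apply/eqP/negPn/negP => u12.
have neqv u : e u v -> u != v by move=> eu; apply: contraTneq eu => ->; rewrite e_irr.
have vr : v != r.
  apply: contraTneq l1 => vr; rewrite vr level_root leqn0 level_eq0 -vr; exact: neqv.
set e' := [rel x y | [&& e x y, x != v & y != v]].
have e'_sym : symmetric e' by move=> x y; rewrite /= e_sym; case: (x != v); case: (y != v).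
have : connect e' u1 u2.
  apply: connect_trans (connect_root_avoiding vr (neqv _ e1) l1) _.
  by rewrite (sym_connect_sym e'_sym) connect_root_avoiding // neqv.
case/connectP => p0 /shortenP[p ep up _ lp].
have pv : v \notin u1 :: p.
  rewrite inE negb_or eq_sym neqv//=; elim: p u1 ep {e1 l1 u12 up lp} => //= x p IHp y.
  by case/andP => /and3P[_ _ xv] /IHp pv; rewrite inE negb_or eq_sym xv.
have /(_ (v :: u1 :: p)) : forall c, ucycle e c -> size c <= 2 by case: tree.
case: p lp ep pv up => [/eqP|y p lp ep pv up]; first by rewrite eq_sym (negPf u12).
move=> short; suff /short : ucycle e [:: v, u1, y & p] by [].
rewrite /ucycle; have -> : uniq [:: v, u1, y & p] by rewrite cons_uniq pv.
rewrite andbT /= rcons_path.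
have /= /andP[-> ->] : path e u1 (y :: p) by apply: sub_path ep => a b /and3P[].
by rewrite /= e_sym e1; move: lp => /= <-; rewrite e2.
Qed.

Lemma parent_uniq u1 u2 v : ch u1 v -> ch u2 v -> u1 = u2.
Proof.
move=> c1 c2; have := level_child c1; have := level_child c2.
case/andP: c1 => e1 _; case/andP: c2 => e2 _ l1 l2.
by apply: (lower_neighbor_uniq e1 e2); lia.
Qed.

(** An edge between two vertices of the same level would give its lower end
    two neighbours that are not below it: the other end and its parent. *)
Lemma edge_child u v : e u v = ch u v || ch v u.
Proof.
apply/idP/orP => [euv|[/andP[]//|]]; last by rewrite e_sym => /andP[].
have euv' := euv; rewrite e_sym in euv'.
rewrite /child euv euv' /=.
case: (ltngtP (lev u) (lev v)) => luv.
- by left; have := level_edge euv; lia.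
- by right; have := level_edge euv'; lia.
have [vr|vr] := eqVneq v r.
  have ur : u = r by apply/eqP; rewrite -level_eq0 luv vr level_root.
  by rewrite ur vr e_irr in euv.
have [p cpv] := parent_exists vr; have lv := level_child cpv.
have epv : e p v by case/andP: cpv.
have up : u = p by apply: (lower_neighbor_uniq euv epv); lia.
rewrite up in luv; lia.
Qed.

Lemma child_ind (P : T -> Prop) : P r ->
  (forall u v, ch u v -> P u -> P v) -> forall v, P v.
Proof.
move=> Pr Pc v; have [n] := ubnP (lev v); elim: n v => // n IHn v lvn.
have [->//|/parent_exists[u cuv]] := eqVneq v r.
by apply: (Pc u) => //; apply: IHn; have := level_child cuv; lia.
Qed.

Lemma ancestor_refl v : anc v v. Proof. exact: connect0. Qed.

Lemma ancestor_root u : anc u r = (u == r).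
Proof.
apply/idP/eqP => [|->]; last exact: ancestor_refl.
case/connectP => p; case/lastP: p => [//|p x]; rewrite rcons_path last_rcons.
by move=> /andP[_ /child_neq_root/eqP xr] rx; case: xr.
Qed.

Lemma ancestor_child p u v : ch p v -> anc u v = (u == v) || anc u p.
Proof.
move=> cpv; apply/idP/orP => [|[/eqP->|up]]; last 2 first.
- exact: ancestor_refl.
- exact: connect_trans up (connect1 cpv).
case/connectP => q; case/lastP: q => [|q x]; first by move=> _ /= ->; left.
rewrite rcons_path last_rcons => /andP[eq cx] vx; subst x; right.
by rewrite (parent_uniq cpv cx); apply/connectP; exists q.
Qed.

Lemma root_ancestor v : anc r v.
Proof.
elim/child_ind: v => [|p v cpv rp]; first exact: ancestor_refl.
by rewrite (ancestor_child _ cpv) rp orbT.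
Qed.

Lemma ancestor_level u v : anc u v -> lev u <= lev v ?= iff (u == v).
Proof.
move=> uv; apply/leqifP; case: eqVneq => [->//|neq_uv].
elim/child_ind: v uv neq_uv => [|p v cpv IHp].
  by rewrite ancestor_root => ->.
rewrite (ancestor_child _ cpv) => /orP[->//|up] _.
rewrite (level_child cpv) ltnS; have [->//|/(IHp up)/ltnW//] := eqVneq u p.
Qed.

Lemma ancestor_chain z1 z2 v : anc z1 v -> anc z2 v -> anc z1 z2 || anc z2 z1.
Proof.
elim/child_ind: v => [|p v cpv IHp].
  by rewrite !ancestor_root => /eqP-> /eqP->; rewrite ancestor_refl.
move=> z1v z2v; move: (z1v) (z2v).
rewrite !(ancestor_child _ cpv) => /orP[/eqP eq1 _|z1p].
  by rewrite eq1 z2v orbT.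
case/orP => [/eqP eq2|]; last exact: IHp.
by rewrite eq2 z1v.
Qed.

(** A strict descendant of u lies below exactly one child of u. *)
Lemma sum_children_ancestor u v :
  (u == v) + \sum_(w | ch u w) anc w v = anc u v.
Proof.
elim/child_ind: v => [|p v cpv IHp].
  rewrite ancestor_root big1 ?addn0// => w /child_neq_root.
  by rewrite ancestor_root => /negPf->.
have vp : anc v p = false.
  apply/negP => /ancestor_level[]; by rewrite (level_child cpv) ltnn.
have disj w : anc w v = (w == v) + anc w p :> nat.
  by rewrite (ancestor_child _ cpv); case: eqVneq => [->|]; rewrite ?vp.
under eq_bigr do rewrite disj.
rewrite big_split /= disj -IHp; congr (_ + (_ + _)).
have [up|up] := eqVneq u p.
  by rewrite up (bigD1 v)//= eqxx big1 // => w /andP[_ /negPf->].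
rewrite big1 // => w cuw; case: eqVneq => // wv; rewrite wv in cuw.
by rewrite (parent_uniq cuw cpv) eqxx in up.
Qed.

(** * The level of the lowest common ancestor *)

(** Counting the non-root common ancestors gives the level of the lowest one,
    and makes the recursion along an edge and the inequalities below
    termwise statements about the ancestors z. *)
Definition common_level u v := \sum_(z | z != r) (anc z u && anc z v).
Local Notation cl := common_level.

Lemma common_levelC u v : cl u v = cl v u.
Proof. by apply: eq_bigr => z _; rewrite andbC. Qed.

Lemma child_not_ancestor p v : ch p v -> anc v p = false.
Proof.
by move=> cpv; apply/negP => /ancestor_level[]; rewrite (level_child cpv) ltnn.
Qed.

Lemma common_level_root v : cl r v = 0.
Proof. by apply: big1 => z /negPf zr; rewrite ancestor_root zr. Qed.

Lemma common_level_child p u v : ch p u -> cl u v = cl p v + anc u v.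
Proof.
move=> cpu; have ur := child_neq_root cpu.
rewrite /cl (bigD1 u)//= [in RHS](bigD1 u)//= ancestor_refl.
rewrite (child_not_ancestor cpu) add0n addnC; congr (_ + _).
by apply: eq_bigr => z /andP[_ /negPf zu]; rewrite (ancestor_child _ cpu) zu.
Qed.

Lemma common_level_ancestor u v : anc u v -> cl u v = lev u.
Proof.
elim/child_ind: u => [|p u cpu IHp] uv; first by rewrite common_level_root level_root.
rewrite (common_level_child _ cpu) uv addn1 (level_child cpu) IHp //.
exact: connect_trans (connect1 cpu) uv.
Qed.

Lemma common_level_self u : cl u u = lev u.
Proof. exact/common_level_ancestor/ancestor_refl. Qed.

Lemma common_level_leq u v : cl u v <= lev u ?= iff anc u v.
Proof.
have le_cl w : cl w v <= lev w.
  elim/child_ind: w => [|p w cpw IHp]; first by rewrite common_level_root.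
  rewrite (common_level_child _ cpw) (level_child cpw); case: (anc w v); lia.
split=> //; apply/eqP/idP; last exact: common_level_ancestor.
elim/child_ind: u => [|p u cpu _]; first by rewrite root_ancestor.
rewrite (common_level_child _ cpu) (level_child cpu); have := le_cl p.
case: (anc u v) => //; lia.
Qed.

(** The level of lowest common ancestors is a kernel of 0-1 features z |-> anc z,
    and for 0-1 numbers, a b + b c <= b + a c. *)
Lemma common_level_split u v w : cl u v + cl v w <= lev v + cl u w.
Proof.
rewrite -(common_level_self v) -!big_split /=; apply: leq_sum => z _.
by case: (anc z u); case: (anc z v); case: (anc z w).
Qed.

Lemma common_level_gt0 u v :
  reflect (exists z, [/\ z != r, anc z u & anc z v]) (0 < cl u v).
Proof.
rewrite lt0n sum_nat_eq0 negb_forall; apply: (iffP existsP) => -[z].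
  by rewrite negb_imply eqb0 negbK => /and3P[]; exists z.
by case=> zr zu zv; exists z; rewrite zr zu zv.
Qed.

(** Lying below the same child of the root is transitive, because the
    ancestors of a vertex form a chain. *)
Lemma common_level_gt0_trans u v w : 0 < cl u v -> 0 < cl u w -> 0 < cl v w.
Proof.
move=> /common_level_gt0[z [zr zu zv]] /common_level_gt0[t [tr tu tw]].
apply/common_level_gt0.
case/orP: (ancestor_chain zu tu) => [zt|tz].
  by exists z; split => //; exact: connect_trans zt tw.
by exists t; split => //; exact: connect_trans tz zv.
Qed.

Lemma sum_neighbors (V : nmodType) (F : T -> V) u :
  (\sum_(w | e u w) F w =
   \sum_(w | ch u w) F w + \sum_(w | ch w u) F w)%R.
Proof.
rewrite (bigID (ch u))/=; congr (_ + _)%R; apply: eq_bigl => w.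
  by rewrite edge_child; case: (ch u w); rewrite ?andbF.
rewrite edge_child; case cuw: (ch u w) => /=; last by rewrite andbT.
apply/esym/negP => cwu; have := level_child cuw; have := level_child cwu; lia.
Qed.

(** [common_level] is the Green function of the tree grounded at r, and 1 unit
    of current injected at v leaves at r.  Across the edge from u to a
    child w the potential rises by 1 exactly when w is an ancestor of v, so the
    flow into u is the flow out of it, except at v and at r. *)
Lemma laplacian_common_level (R : pzRingType) u v :
  (\sum_(w | e u w) ((cl u v)%:R - (cl w v)%:R) = (u == v)%:R - (u == r)%:R :> R)%R.
Proof.
rewrite sum_neighbors.
have -> : (\sum_(w | ch u w) ((cl u v)%:R - (cl w v)%:R) = (u == v)%:R - (anc u v)%:R :> R)%R.
  rewrite -(sum_children_ancestor u v) natrD opprD addrA subrr sub0r natr_sum -sumrN.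
  apply: eq_bigr => w cuw; rewrite (common_level_child _ cuw) natrD opprD addrA.
  by rewrite subrr sub0r.
rewrite -addrA; congr (_ + _)%R.
have [->|/parent_exists[p cpu]] := eqVneq u r.
  rewrite root_ancestor big_pred0 ?addr0// => w.
  by apply/negP => /child_neq_root; rewrite eqxx.
rewrite (big_pred1 p) => [|w]; last first.
  by apply/idP/eqP => [cwu|->//]; exact: parent_uniq cwu cpu.
by rewrite (common_level_child _ cpu) natrD [X in (_ + X)%R]addrAC subrr add0r addNr oppr0.
Qed.

Lemma sum_descendants (F : T -> nat) u :
  \sum_(v | anc u v) F v = F u + \sum_(w | ch u w) \sum_(v | anc w v) F v.
Proof.
have sumE w : \sum_(v | anc w v) F v = \sum_v anc w v * F v.
  by rewrite big_mkcond; apply: eq_bigr => v _; case: (anc w v); rewrite ?mul1n.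
rewrite sumE (eq_bigr _ (fun w _ => sumE w)) exchange_big /=.
under eq_bigr => v _ do rewrite -sum_children_ancestor mulnDl big_distrl /=.
rewrite big_split /=; congr (_ + _).
rewrite (bigD1 u)//= eqxx mul1n big1 ?addn0// => v; by rewrite eq_sym => /negPf->.
Qed.

(** * Counting in a perfect ternary tree *)
Definition subtree_size u := \sum_(v | anc u v) 1.

Variable h : nat.
Hypothesis perfect : perfect_ternary_tree e r h.

Lemma level_le_height u : lev u <= h.
Proof.
have [t _ tmax] : exists2 t, true & forall v, lev v <= lev t.
  by exists [arg max_(t > r) lev t] => //; case: arg_maxnP => // t _ + v; apply.
suff <- : lev t = h by [].
case: perfect => _ _; apply; apply/eqP/setP => w; rewrite !inE.
by apply/negP => /level_child lw; have := tmax w; rewrite lw ltnn.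
Qed.

Lemma card_children u : lev u < h -> #|children e r u| = 3.
Proof.
case: perfect => _ card3 leafh lt_u; apply: card3; apply/negP => /leafh lu.
by rewrite lu ltnn in lt_u.
Qed.

Lemma no_children u : lev u = h -> ch u =1 pred0.
Proof.
move=> lu w; apply/negP => /level_child lw.
by have := level_le_height w; rewrite lw lu ltnn.
Qed.

Lemma sum_children_const (F : T -> nat) u c : lev u < h ->
  (forall w, ch u w -> F w = c) -> \sum_(w | ch u w) F w = 3 * c.
Proof.
move=> /card_children <- Fc; rewrite (eq_bigr (fun=> c) Fc) sum_nat_const.
by congr (_ * _); apply: eq_card => w; rewrite !inE.
Qed.

Lemma height_ind (P : T -> Prop) : (forall u, lev u = h -> P u) ->
  (forall u, lev u < h -> (forall w, ch u w -> P w) -> P u) -> forall u, P u.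
Proof.
move=> Ph Pc u; have [n] := ubnP (h - lev u); elim: n u => // n IHn u lt_n.
have := level_le_height u; rewrite leq_eqVlt => /orP[/eqP|lt_u]; first exact: Ph.
by apply: Pc => // w /level_child lw; apply: IHn; rewrite lw; lia.
Qed.

Lemma card_descendants u : 2 * subtree_size u + 1 = 3 ^ (h - lev u).+1.
Proof.
rewrite /subtree_size; elim/height_ind: u => u lu => [|IHu]; rewrite sum_descendants.
  by rewrite (big_pred0 _ _ _ _ (no_children lu)) lu subnn.
rewrite mulnDr big_distrr /=.
suff : \sum_(w | ch u w) (2 * (\sum_(v | anc w v) 1) + 1) = 3 * 3 ^ (h - lev u).
  by rewrite big_split/= (@sum_children_const (fun=> 1) u 1)//= expnS; lia.
by apply: sum_children_const => // w cw; rewrite IHu // (level_child cw) subnSK.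
Qed.

Lemma card_descendants_child p u : ch p u -> subtree_size p = 3 * subtree_size u + 1.
Proof.
move=> cpu; have := card_descendants p; have := card_descendants u.
have := level_le_height u; rewrite (level_child cpu) => lt_p.
rewrite (subnSK lt_p) [3 ^ (h - lev p).+1]expnS; lia.
Qed.

(** Closed form of the arithmetico-geometric sum of the levels; stated
    without subtraction or division so that it holds in nat. *)
Lemma sum_levels_below u :
  4 * (\sum_(v | anc u v) lev v) + 3 ^ (h - lev u).+1 + 2 * lev u
  = 2 * h * 3 ^ (h - lev u).+1 + 3.
Proof.
elim/height_ind: u => u lu => [|IHu]; rewrite sum_descendants.
  by rewrite (big_pred0 _ _ _ _ (no_children lu)) lu subnn; lia.
suff : \sum_(w | ch u w)
    (4 * (\sum_(v | anc w v) lev v) + 3 ^ (h - lev u) + 2 * (lev u).+1)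
    = 3 * (2 * h * 3 ^ (h - lev u) + 3).
  rewrite !big_split/= -!big_distrr/= !(sum_children_const lu (fun _ _ => erefl)).
  by rewrite expnS; lia.
apply: sum_children_const => // w cw; have := IHu _ cw.
by rewrite (level_child cw) subnSK.
Qed.

(** In the rest of the section, m is the size of the subtree below a child of
    the root. *)
Variable m : nat.
Hypothesis m_def : 2 * m + 1 = 3 ^ h.

Lemma subtree_size_top u : lev u = 1 -> subtree_size u = m.
Proof.
move=> lu; have := card_descendants u; have := level_le_height u; rewrite lu => h0.
by rewrite subnSK // subn0; lia.
Qed.

Lemma card_tree : #|T| = 3 * m + 1.
Proof.
have -> : #|T| = subtree_size r.
  by rewrite /subtree_size -sum1_card; apply: eq_bigl => v; rewrite root_ancestor.
by have := card_descendants r; rewrite level_root subn0 expnS -m_def; lia.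
Qed.

Lemma sum_levels : 4 * (\sum_v lev v) + 3 ^ h.+1 = 2 * h * 3 ^ h.+1 + 3.
Proof.
have := sum_levels_below r; rewrite level_root subn0 addn0.
by rewrite (eq_bigl xpredT) //; exact: root_ancestor.
Qed.

Lemma nonroot_ind (P : T -> Prop) : (forall u, lev u = 1 -> P u) ->
  (forall p u, 0 < lev p -> ch p u -> P p -> P u) -> forall u, 0 < lev u -> P u.
Proof.
move=> P1 Pc; elim/child_ind => [|p u cpu IHp _]; first by rewrite level_root.
have [lp|lp] := posnP (lev p); last exact: Pc lp cpu (IHp lp).
by apply: P1; rewrite (level_child cpu) lp.
Qed.

(** One level down, the size is divided by more than 3 while 2 k - 1 is
    multiplied by at most 3.  The factor 2 k - 1 is the increment of k^2 in
    [sum_sqr_common_level]. *)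
Lemma subtree_size_leq u : 0 < lev u -> (2 * lev u - 1) * subtree_size u <= m.
Proof.
move: u; apply: nonroot_ind => [u lu|p u lp cpu].
  by rewrite (subtree_size_top lu) lu mul1n.
rewrite (card_descendants_child cpu) (level_child cpu) => IHp.
apply: leq_trans IHp; nia.
Qed.

Lemma sum_ancestorE u : \sum_v anc u v = subtree_size u.
Proof. by rewrite /subtree_size [RHS]big_mkcond; apply: eq_bigr => v _; case: (anc u v). Qed.

(** The sum over v equals that of the sizes of the subtrees along the path from
    the root, excluded, to u, which decrease at least like powers of 1/3.  The
    term [subtree_size u] bounds twice the tail of this series, which makes
    the induction on u go through. *)
Lemma sum_common_level u : 0 < lev u -> 2 * (\sum_v cl u v) + subtree_size u <= 3 * m.
Proof.
move: u; apply: nonroot_ind => [u lu|p u lp cpu].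
  rewrite (eq_bigr (fun v => anc u v : nat)); last first.
    move=> v _; have [p cpu] : exists p, ch p u.
      by apply: parent_exists; rewrite -level_eq0 lu.
    rewrite (common_level_child _ cpu); have := level_child cpu.
    rewrite lu => -[/esym/eqP]; rewrite level_eq0 => /eqP->.
    by rewrite common_level_root.
  rewrite sum_ancestorE (subtree_size_top lu); lia.
rewrite (card_descendants_child cpu).
under [X in _ -> 2 * X + _ <= _]eq_bigr do rewrite (common_level_child _ cpu).
by rewrite big_split/= sum_ancestorE; lia.
Qed.

(** When u is a child of p, the square grows by 2 (lev u) - 1 at each
    descendant of u and nowhere else. *)
Lemma sum_sqr_common_level u : \sum_v cl u v ^ 2 <= lev u * m.
Proof.
elim/child_ind: u => [|p u cpu IHp].
  by rewrite big1 // => v _; rewrite common_level_root.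
have step v : cl u v ^ 2 = cl p v ^ 2 + (2 * lev u - 1) * anc u v.
  rewrite (common_level_child _ cpu); case uv: (anc u v); last by rewrite muln0 !addn0.
  rewrite (@common_level_ancestor p); last exact: connect_trans (connect1 cpu) uv.
  by rewrite (level_child cpu); lia.
under eq_bigr do rewrite step.
rewrite big_split/= -big_distrr /= sum_ancestorE.
have := @subtree_size_leq u; rewrite (level_child cpu) => /(_ isT).
by rewrite mulSn; lia.
Qed.

Lemma card_common_level_gt0 u : 0 < lev u -> \sum_v (0 < cl u v) = m.
Proof.
move: u; apply: nonroot_ind => [u lu|p u lp cpu IHp].
  rewrite -(subtree_size_top lu) -sum_ancestorE; apply: eq_bigr => v _.
  have [+ <-] := common_level_leq u v; rewrite lu; by case: (cl u v) => [|[]].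
rewrite -IHp; apply: eq_bigr => v _; rewrite (common_level_child _ cpu).
case uv: (anc u v); last by rewrite addn0.
rewrite addn1 ltn0Sn common_level_ancestor ?lp //.
exact: connect_trans (connect1 cpu) uv.
Qed.

End RootedTree.

(** * The coherence as a sum of effective resistances *)

(** A kernel that vanishes at the leaders and whose Laplacian is the identity
    on the followers is the inverse of the follower block. *)
Lemma coherence_green (R : realType) (T : finType) (e : rel T) (S : {set T})
    (g : T -> T -> R) :
  (forall w v, w \in S -> g w v = 0) ->
  (forall u v, u \notin S -> v \notin S ->
     \sum_(w | e u w) (g u v - g w v) = (u == v)%:R) ->
  coherence e R S = 2^-1 * \sum_v g v v.
Proof.
move=> gS gL; rewrite /coherence; congr (_ * _).
set M := principal_submx _ _.
pose G : 'M[R]_#|~: S| := \matrix_(i, j) g (enum_val i) (enum_val j).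
have notS (i : 'I_#|~: S|) : enum_val i \notin S by rewrite -in_setC enum_valP.
have MG1 : M *m G = 1%:M.
  apply/matrixP => i j; rewrite !mxE.
  set u := enum_val i; set v := enum_val j.
  have -> : (i == j)%:R = (u == v)%:R :> R by rewrite (inj_eq enum_val_inj).
  rewrite -gL ?notS // sumrB sumr_const -mulr_natl.
  pose F w : R := (#|e u|%:R *+ (u == w) - (e u w)%:R) * g w v.
  transitivity (\sum_(k < #|~: S|) F (enum_val k)).
    apply: eq_bigr => k _; rewrite !mxE !enum_rankK; congr ((_ - _) * _).
    by rewrite (inj_eq enum_rank_inj).
  rewrite -(big_enum_val F) /=.
  transitivity (\sum_w F w).
    rewrite [RHS](bigID [in ~: S])/= [X in _ + X]big1 ?addr0// => w.
    by rewrite inE negbK /F => /gS ->; rewrite mulr0.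
  rewrite (eq_bigr _ (fun w _ => mulrBl _ _ _)) sumrB; congr (_ - _).
    rewrite (bigD1 u)//= eqxx mulr1n big1 ?addr0// => w.
    by rewrite eq_sym => /negPf->; rewrite mulr0n mul0r.
  rewrite [RHS]big_mkcond; apply: eq_bigr => w _.
  by case: (e u w); rewrite ?mul1r ?mul0r.
have [Mu _] := mulmx1_unit MG1.
have -> : invmx M = G by rewrite -[RHS](mulKmx Mu) MG1 mulmx1.
rewrite [RHS](bigID [in ~: S])/= [X in _ + X]big1 ?addr0; last first.
  by move=> w; rewrite inE negbK => /gS.
rewrite /mxtrace [RHS]big_enum_val; by apply: eq_bigr => i _; rewrite mxE.
Qed.

Section TreeCoherence.
Variables (R : realType) (T : finType) (e : rel T) (r : T).
Hypothesis tree : is_tree e.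
Local Notation lev := (level e r).
Local Notation cl := (common_level e r).
Local Notation "u @ v" := ((cl u v)%:R : R) (at level 20).
(** [green x] is the Green function grounded at x instead of r: the polarised
    distance (d(u,x) + d(v,x) - d(u,v)) / 2. *)
Let green x u v : R := u @ v - u @ x - x @ v + x @ x.

Lemma laplacian_green x u v :
  \sum_(w | e u w) (green x u v - green x w v) = (u == v)%:R - (u == x)%:R.
Proof.
transitivity (\sum_(w | e u w) (u @ v - w @ v) - \sum_(w | e u w) (u @ x - w @ x)).
  by rewrite -sumrB; apply: eq_bigr => w _; rewrite /green; ring.
by rewrite !laplacian_common_level //; ring.
Qed.

Lemma green_leader x v : green x x v = 0.
Proof. by rewrite /green; ring. Qed.

Lemma green_diag x v :
  green x v v = (lev v)%:R - 2 * v @ x + (lev x)%:R.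
Proof.
by rewrite /green !common_level_self // (common_levelC _ _ x v); ring.
Qed.

Lemma coherence_single x : coherence e R [set x] =
  2^-1 * \sum_v ((lev v)%:R - 2 * v @ x + (lev x)%:R).
Proof.
under eq_bigr do rewrite -green_diag.
apply: coherence_green => [w v /set1P->|u v]; first exact: green_leader.
by rewrite !inE laplacian_green => /negPf-> _; rewrite subr0.
Qed.

(** The quantity is the distance between x and y; it vanishes only when the
    lowest common ancestor has the level of both x and y. *)
Lemma leaders_dist_gt0 x y : x != y ->
  0 < (lev x)%:R + (lev y)%:R - 2 * x @ y :> R.
Proof.
move=> xy; rewrite subr_gt0 -natrM -natrD ltr_nat.
have [lx ex] := common_level_leq r tree x y.
have [ly ey] := common_level_leq r tree y x.
rewrite common_levelC in ly ey.
rewrite ltn_neqAle; apply/andP; split; last by lia.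
apply/eqP => eq2; have /(ancestor_level tree) xley : ancestor e r x y by rewrite -ex; lia.
by case: xley => _; rewrite (negPf xy) => /negP; apply; apply/eqP; lia.
Qed.

(** Grounding y after x subtracts from [green x] the rank-one kernel that
    cancels its row at y. *)
Lemma coherence_pair x y : x != y -> coherence e R [set x; y] =
  2^-1 * \sum_v ((lev v)%:R - 2 * v @ x + (lev x)%:R
     - ((lev x)%:R + v @ y - v @ x - x @ y) ^+ 2
       / ((lev x)%:R + (lev y)%:R - 2 * x @ y)).
Proof.
move=> xy; set D := (lev x)%:R + (lev y)%:R - _.
have D_neq0 : D != 0 by rewrite gt_eqF // leaders_dist_gt0.
have greenD : green x y y = D.
  by rewrite green_diag (common_levelC _ _ y x) /D; ring.
have green_sym u v : green x u v = green x v u.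
  rewrite /green (common_levelC _ _ u v) (common_levelC _ _ u x).
  by rewrite (common_levelC _ _ v x); ring.
pose g u v : R := green x u v - green x u y * green x y v / D.
rewrite (@coherence_green _ _ _ _ g) => [|w v|u v].
- congr (_ * _); apply: eq_bigr => v _; rewrite /g green_diag (green_sym y v) -expr2.
  congr (_ - _ ^+ 2 / _); rewrite /green common_level_self //; ring.
- rewrite !inE /g => /orP[] /eqP->; first by rewrite !green_leader mul0r mul0r subr0.
  by rewrite greenD mulrAC divff// mul1r subrr.
rewrite !inE !negb_or => /andP[/negPf ux /negPf uy] _.
transitivity (\sum_(w | e u w) (green x u v - green x w v) -
   (\sum_(w | e u w) (green x u y - green x w y)) * (green x y v / D)).
  by rewrite mulr_suml -sumrB; apply: eq_bigr => w _; rewrite /g; ring.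
by rewrite !laplacian_green ux uy !subr0 mul0r subr0.
Qed.

(** * Comparison of all leader sets *)
Variables (h m : nat).
Hypothesis perfect : perfect_ternary_tree e r h.
Hypothesis m_def : (2 * m + 1 = 3 ^ h)%N.
Hypothesis m_gt1 : (1 < m)%N.

Let Lam : R := \sum_v (lev v)%:R.
(** Twice the coherence of two distinct children of the root. *)
Definition optimal_total : R := Lam - 2 * m%:R + (m%:R + 1) / 2.

Let sum_const (k : R) : \sum_(v : T) k = (3 * m%:R + 1) * k.
Proof.
by rewrite sumr_const (card_tree tree perfect m_def) -[LHS]mulr_natl natrD natrM.
Qed.

Lemma optimal_total_value :
  2^-1 * optimal_total = 3 ^+ h.+1 / 4 * (h%:R - 1) + 1.
Proof.
have := sum_levels tree perfect; rewrite expnS -m_def => /(congr1 (fun k => k%:R : R)).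
rewrite !(natrD, natrM) natr_sum -/Lam /optimal_total => eqL.
have -> : 3 ^+ h.+1 = 3 * (2 * m%:R + 1) :> R.
  by rewrite exprS -natrX -m_def natrD natrM.
by move: eqL; set H := h%:R; set M := m%:R => eqL; nra.
Qed.

Lemma single_suboptimal x : 2^-1 * optimal_total < coherence e R [set x].
Proof.
rewrite coherence_single ltr_pM2l ?invr_gt0// /optimal_total.
rewrite big_split/= sumrB sum_const -mulr_sumr -/Lam.
have m1 : 1 < m%:R :> R by rewrite ltr1n.
have [lx|lx] := posnP (lev x).
  have -> : \sum_v v @ x = 0.
    apply: big1 => v _; move/eqP: lx; rewrite level_eq0 // => /eqP->.
    by rewrite common_levelC common_level_root.
  by rewrite lx; lra.
have := sum_common_level tree perfect m_def lx.
under eq_bigr do rewrite common_levelC.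
move=> bound; have {}bound : 2 * \sum_v v @ x <= 3 * m%:R.
  by rewrite -natr_sum -!natrM ler_nat (leq_trans (leq_addr _ _) bound).
have : 1 <= (lev x)%:R :> R by rewrite ler1n.
set a := (lev x)%:R; nra.
Qed.

Let m1 : 1 < m%:R :> R. Proof. by rewrite ltr1n. Qed.

Let sum_sqr_depth x : \sum_v (v @ x) ^+ 2 <= (lev x)%:R * m%:R.
Proof.
have := sum_sqr_common_level tree perfect m_def x.
under eq_bigr do rewrite common_levelC.
rewrite -(ler_nat R) natrM natr_sum; apply: le_trans.
by apply: ler_sum => v _; rewrite natrX.
Qed.

Let sum_sqr_depth_div x : (0 < lev x)%N -> \sum_v (v @ x) ^+ 2 / (lev x)%:R <= m%:R.
Proof.
move=> lx; rewrite -mulr_suml ler_pdivrMr ?ltr0n// mulrC; exact: sum_sqr_depth.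
Qed.

Let sum_depth x : (0 < lev x)%N -> 2 * \sum_v v @ x <= 3 * m%:R.
Proof.
move=> lx; rewrite -natr_sum -!natrM ler_nat; under eq_bigr do rewrite common_levelC.
exact: leq_trans (leq_addr _ _) (sum_common_level tree perfect m_def lx).
Qed.

Lemma leader_at_root_suboptimal y : y != r ->
  2^-1 * optimal_total < coherence e R [set r; y].
Proof.
move=> yr; have ly : (0 < lev y)%N by rewrite lt0n level_eq0.
have b0 : (0 : R) < (lev y)%:R by rewrite ltr0n.
rewrite coherence_pair 1?eq_sym// ltr_pM2l ?invr_gt0//.
have -> : \sum_v ((lev v)%:R - 2 * v @ r + (lev r)%:R
     - ((lev r)%:R + v @ y - v @ r - r @ y) ^+ 2
       / ((lev r)%:R + (lev y)%:R - 2 * r @ y))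
    = Lam - \sum_v (v @ y) ^+ 2 / (lev y)%:R.
  rewrite /Lam -sumrB; apply: eq_bigr => v _.
  rewrite (common_levelC _ _ v r) !common_level_root // level_root.
  by congr (_ - _ ^+ 2 / _); ring.
by have := sum_sqr_depth_div ly; have := m1; rewrite /optimal_total; lra.
Qed.

(** The resistance between v and {x, y} is at least the distance from v to the
    path joining x and y.  Since both leaders are below the same child of the
    root, each of the 3 m + 1 vertices gains q >= 1, which outweighs the
    two sums of common levels, each at most 3 m / 2. *)
Lemma same_branch_suboptimal x y : x != y -> (0 < cl x y)%N ->
  2^-1 * optimal_total < coherence e R [set x; y].
Proof.
move=> xy q0; have m_pos := m1; rewrite coherence_pair// ltr_pM2l ?invr_gt0//.
set q := x @ y; set a : R := (lev x)%:R; set b : R := (lev y)%:R.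
have D0 : 0 < a + b - 2 * q by exact: leaders_dist_gt0.
have lx : (0 < lev x)%N by apply: leq_trans q0 _; case: (common_level_leq r tree x y).
have ly : (0 < lev y)%N.
  by apply: leq_trans q0 _; rewrite common_levelC; case: (common_level_leq r tree y x).
have q1 : 1 <= q by rewrite ler1n.
apply: (@lt_le_trans _ _ (\sum_v ((lev v)%:R - v @ x - v @ y + q))).
  rewrite big_split/= !sumrB sum_const -/Lam /optimal_total.
  have : 3 * m%:R + 1 <= (3 * m%:R + 1) * q by rewrite ler_peMr //; lra.
  by have := sum_depth lx; have := sum_depth ly; lra.
apply: ler_sum => v _; set i := v @ x; set j := v @ y.
have k0 : 0 <= a + j - i - q.
  have := common_level_split r tree v x y; rewrite -(ler_nat R) !natrD -/a -/q -/i -/j; lra.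
have kD : 0 <= b + i - j - q.
  have := common_level_split r tree v y x; rewrite -(ler_nat R) !natrD.
  by rewrite (common_levelC e r y x) -/b -/q -/i -/j; lra.
suff : (a + j - i - q) ^+ 2 / (a + b - 2 * q) <= a + j - i - q by lra.
by rewrite ler_pdivrMr // expr2 ler_wpM2l //; lra.
Qed.

(** In the branch of x, the resistance is bounded below by grounding also the
    root, where it is l - i^2 / a; likewise for y.  The two branches have m
    vertices each, which leaves m + 1 vertices attached to the root. *)
Lemma distinct_branches_bound x y : (0 < lev x)%N -> (0 < lev y)%N -> cl x y = 0%N ->
  2^-1 * (Lam - 2 * m%:R +
    (m%:R + 1) * ((lev x)%:R * (lev y)%:R / ((lev x)%:R + (lev y)%:R)))
  <= coherence e R [set x; y].
Proof.
move=> lx ly q0.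
have xy : x != y by apply: contraTneq lx => xy; rewrite -(common_level_self r tree) {2}xy q0.
rewrite coherence_pair// ler_pM2l ?invr_gt0// q0 mulr0 subr0.
set a : R := (lev x)%:R; set b : R := (lev y)%:R.
have a0 : 0 < a by rewrite ltr0n.
have b0 : 0 < b by rewrite ltr0n.
set c := a * b / (a + b).
apply: (@le_trans _ _ (\sum_v ((lev v)%:R - (v @ x) ^+ 2 / a - (v @ y) ^+ 2 / b
    + (1 - (0 < cl v x)%:R - (0 < cl v y)%:R) * c))).
  rewrite big_split/= -[X in _ <= _ + X]mulr_suml !sumrB sum_const -/Lam.
  have count z : (0 < lev z)%N -> \sum_v (0 < cl v z)%:R = m%:R :> R.
    move=> lz; rewrite -(card_common_level_gt0 tree perfect m_def lz) natr_sum.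
    by apply: eq_bigr => v _; rewrite common_levelC.
  rewrite !count//; have := sum_sqr_depth_div lx; have := sum_sqr_depth_div ly.
  by rewrite -/a -/b; nra.
apply: ler_sum => v _; rewrite subr0.
(* Grounding the root as well lowers the resistance by the last term. *)
have shift (d i : R) : 0 < d ->
    d - 2 * i - (d - i) ^+ 2 / (a + b) = - (i ^+ 2 / d) + (d - i) ^+ 2 * (d^-1 - (a + b)^-1).
  by move=> d0; field; rewrite !gt_eqF // addr_gt0.
have gain (d i : R) : 0 < d -> d <= a + b -> 0 <= (d - i) ^+ 2 * (d^-1 - (a + b)^-1).
  by move=> d0 dab; rewrite mulr_ge0 ?sqr_ge0// subr_ge0 lef_pV2 // posrE addr_gt0.
have [vx|vx] := posnP (cl v x); have [vy|vy] := posnP (cl v y).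
- rewrite vx vy le_eqVlt; apply/orP; left; apply/eqP; rewrite /c /=.
  by field; rewrite !gt_eqF // addr_gt0.
- rewrite vx mulr1n mulr0n; have := shift b (v @ y) b0; have := gain b (v @ y) b0.
  have -> : (a + v @ y - 0) ^+ 2 / (a + b)
      = a - b + 2 * v @ y + (b - v @ y) ^+ 2 / (a + b).
    by field; rewrite gt_eqF // addr_gt0.
  by lra.
- rewrite vy mulr1n mulr0n; have := shift a (v @ x) a0; have := gain a (v @ x) a0.
  have -> : a + 0 - v @ x = a - v @ x by ring.
  by lra.
by have := common_level_gt0_trans tree vx vy; rewrite q0.
Qed.

(** At level 1 the common level with a leader is 0 or 1, and each bound used
    for leaders in distinct branches is attained. *)
Lemma top_leaders_coherence x y : x != y -> lev x = 1%N -> lev y = 1%N ->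
  coherence e R [set x; y] = 2^-1 * optimal_total.
Proof.
move=> xy lx ly; rewrite coherence_pair//; congr (_ * _).
have q0 : cl x y = 0%N.
  apply/eqP; rewrite -leqn0 leqNgt; apply/negP => q1.
  have [le1 eq1] := common_level_leq r tree x y.
  have xy' : ancestor e r x y by rewrite -eq1; apply/eqP; lia.
  by have [_] := ancestor_level tree xy'; rewrite lx ly (negPf xy).
rewrite lx ly q0.
(* near z v indicates that v lies below z. *)
pose near z v : R := (0 < cl v z)%:R.
have clE z v : lev z = 1%N -> v @ z = near z v.
  move=> lz; have [+ _] := common_level_leq r tree z v.
  by rewrite lz common_levelC /near; case: (cl v z) => [|[]].
rewrite (eq_bigr (fun v => (lev v)%:R + (- near x v - near y v) * (3 / 2) + 1 / 2)).
  rewrite !big_split/= -mulr_suml sumrB sumrN sum_const -/Lam.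
  have count z : lev z = 1%N -> \sum_v near z v = m%:R.
    move=> lz; have lz0 : (0 < lev z)%N by rewrite lz.
    rewrite -(card_common_level_gt0 tree perfect m_def lz0) natr_sum.
    by apply: eq_bigr => v _; rewrite common_levelC.
  by rewrite !count // /optimal_total; field.
move=> v _; rewrite !clE // /near.
have [vx|vx] := posnP (cl v x); have [vy|vy] := posnP (cl v y) => /=; last first.
  by have := common_level_gt0_trans tree vx vy; rewrite q0.
all: by field.
Qed.

Lemma pair_suboptimal x y : x != y -> (lev x != 1%N) || (lev y != 1%N) ->
  2^-1 * optimal_total < coherence e R [set x; y].
Proof.
move=> xy.
have [x0|lx] := posnP (lev x).
  move/eqP: x0; rewrite level_eq0 // => /eqP xr _; subst x.
  by apply: leader_at_root_suboptimal; rewrite eq_sym.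
have [y0|ly] := posnP (lev y).
  move/eqP: y0; rewrite level_eq0 // => /eqP yr _; subst y.
  by rewrite setUC; apply: leader_at_root_suboptimal.
have [q0|q0] := posnP (cl x y); last by move=> _; apply: same_branch_suboptimal.
move=> far; apply: lt_le_trans (distinct_branches_bound lx ly q0).
rewrite ltr_pM2l ?invr_gt0// /optimal_total ltrD2l ltr_pM2l; last first.
  by have := m1; lra.
(* This is 1/2 < a b / (a + b), strict because a and b are not both 1. *)
have : (lev x + lev y < 2 * (lev x * lev y))%N by nia.
rewrite -(ltr_nat R) natrD !natrM => close.
by rewrite ltr_pdivlMr ?addr_gt0 ?ltr0n //; lra.
Qed.

End TreeCoherence.

(** * The optimal leaders *)
Lemma pair_set (T : finType) (S : {set T}) : S != set0 -> (#|S| <= 2)%N ->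
  exists x y, S = [set x; y].
Proof.
rewrite -card_gt0; case cS: #|S| => [|[|[|k]]] // _ _.
  by move/eqP/cards1P: cS => [x ->]; exists x, x; rewrite setUid.
by move/eqP/cards2P: cS => [x [y [_ ->]]]; exists x, y.
Qed.

Theorem theorem13 (R : realType) (T : finType) (e : rel T) (r : T) (h : nat) :
  perfect_ternary_tree e r h -> (4 <= h)%N ->
  (exists x y : T, (level e r x <= level e r y)%N
                   /\ optimal_leaders e R 2 [set x; y])
  /\
  (forall x y : T, (level e r x <= level e r y)%N ->
     optimal_leaders e R 2 [set x; y] ->
     [/\ is_lca e r r x y,
         dist e x y = 2%N,
         dist e x r = 1%N
       & coherence e R [set x; y]
         = (2 * #|T|%:R + 1) / 4 * (ln (2 * #|T|%:R + 1) / ln 3 - 2) + 1]).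
Proof.
move=> perfect h4; have tree : is_tree e by case: perfect.
have [[e_sym e_irr] _ _] := tree.
pose m := ((3 ^ h).-1)./2.
have m_def : (2 * m + 1 = 3 ^ h)%N.
  have := odd_double_half (3 ^ h).-1; rewrite -/m.
  have : odd (3 ^ h) by rewrite oddX orbT.
  have := expn_gt0 3 h; case: (3 ^ h)%N => //= k _ /negPf->; lia.
have m_gt1 : (1 < m)%N.
  have : (3 ^ 4 <= 3 ^ h)%N by rewrite leq_pexp2l.
  by rewrite -m_def; lia.
have opt_top := top_leaders_coherence R tree perfect m_def.
have opt_far := pair_suboptimal R tree perfect m_def m_gt1.
have opt1 := single_suboptimal R tree perfect m_def m_gt1.
set opt := 2^-1 * optimal_total R e r m in opt_top opt_far opt1.
have [x [y [xy cx cy]]] : exists x y, [/\ x != y, child e r r x & child e r r y].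
  have : (1 < #|children e r r|)%N by rewrite (card_children perfect) // level_root; lia.
  by case/card_gt1P => x [y [+ + xy]]; rewrite !inE => cx cy; exists x, y.
have lev1 z : child e r r z -> level e r z = 1%N.
  by move/level_child->; rewrite level_root.
have opt_xy : coherence e R [set x; y] = opt by apply: opt_top; rewrite ?lev1.
have opt_min S : S != set0 -> (#|S| <= 2)%N -> opt <= coherence e R S.
  move=> S0 S2; have [u [v ->]] := pair_set S0 S2.
  have [->|uv] := eqVneq u v; first by rewrite setUid ltW.
  case luv: ((level e r u != 1%N) || (level e r v != 1%N)); first exact/ltW/opt_far.
  by move/norP: luv => [/negbNE/eqP lu /negbNE/eqP lv]; rewrite opt_top.
split.
  exists x, y; rewrite !lev1 //; split=> //; split.
  - by apply/set0Pn; exists x; rewrite !inE eqxx.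
  - by rewrite cards2; case: (_ != _).
  - by move=> S S0 S2; rewrite opt_xy opt_min.
move=> u v _ [_ _ /(_ [set x; y])].
rewrite opt_xy cards2 -card_gt0 cards2 xy => /(_ isT isT) le_opt.
have uv : u != v by apply: contraTneq le_opt => ->; rewrite setUid -ltNge.
have /norP[/negbNE/eqP lu /negbNE/eqP lv] :
    ~~ ((level e r u != 1%N) || (level e r v != 1%N)).
  by apply: contraTN le_opt => luv; rewrite -ltNge opt_far.
have child_top z : level e r z = 1%N -> child e r r z.
  move=> lz; have [|p cpz] := @parent_exists _ _ r tree z.
    by rewrite -(level_eq0 r tree) lz.
  have /eqP : level e r p = 0%N by have := level_child cpz; rewrite lz; lia.
  by rewrite (level_eq0 r tree) => /eqP pr; rewrite pr in cpz.
have /andP[eru _] := child_top u lu; have /andP[erv _] := child_top v lv.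
have eur : e u r by rewrite e_sym.
have dist_gt0 a b : a != b -> (0 < dist e a b)%N.
  move=> ab; rewrite lt0n; apply: contra_neq ab; apply: dist_eq0.
  by case: tree.
split.
- split; [exact: root_ancestor|exact: root_ancestor|move=> z zu zv].
  have [le_zu eq_zu] := ancestor_level tree zu.
  have [le_zv eq_zv] := ancestor_level tree zv.
  rewrite level_root leqNgt; apply/negP => z1.
  have lz : level e r z = 1%N by apply/eqP; rewrite eqn_leq z1 -lu le_zu.
  have /eqP zu_eq : z == u by rewrite -eq_zu lz lu.
  by move: eq_zv; rewrite zu_eq lu lv (negPf uv).
- apply/eqP; rewrite eqn_leq; apply/andP; split.
    by apply: (@dist_leq _ e u [:: r; v]); rewrite /= eur erv.
  rewrite ltn_neqAle dist_gt0 // andbT; apply/eqP => d1.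
  have [p [ep lp sp]] : exists p, [/\ path e u p, last u p = v & size p = dist e u v].
    by apply: dist_path; case: tree.
  case: p ep lp sp => [|w [|w' p]] //=; rewrite -d1 // andbT => euw wv _.
  move: euw; rewrite wv (edge_child r tree).
  by case/orP => /level_child; rewrite lu lv.
- apply/eqP; rewrite eqn_leq dist_gt0; last by apply: contraTneq eru => ->; rewrite e_irr.
  by rewrite andbT; apply: (@dist_leq _ e u [:: r]); rewrite /= eur.
rewrite opt_top // /opt (optimal_total_value R tree perfect m_def).
have -> : 2 * #|T|%:R + 1 = 3 ^+ h.+1 :> R.
  rewrite (card_tree tree perfect m_def) exprS -natrX -m_def !(natrD, natrM); ring.
have ln3 : ln 3 != 0 :> R by rewrite gt_eqF // ln_gt0 // ltr1n.
rewrite lnXn //.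
have -> : ln 3 *+ h.+1 = (h%:R + 1) * ln 3 :> R by rewrite -[LHS]mulr_natl -natr1.
set P := 3 ^+ _.
by field.
Qed.
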